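(* Let $\mathfrak b\subset\mathfrak a$ be homogeneous Gorenstein ideals of grades $g-1$ and $g$ in the graded Gorenstein ring $R$, with $d=u-v\ge0$, and let $y$, $\omega$, $f$ and the ideal $I=(\mathfrak b,\omega+fy):[(\mathfrak b,y):\mathfrak a]$ be as described in the context. Then, for all integers $j$, the Hilbert function of $R/I$ is given by $$\mathfrak h_{R/I}(j)=\mathfrak h_{R/\mathfrak a}(j-d)+\mathfrak h_{R/\mathfrak b}(j)-\mathfrak h_{R/\mathfrak b}(j-d).$$
   Context: Conventions: $R=\bigoplus_{j\ge0}[R]_j$ is a commutative Noetherian graded Gorenstein ring, generated as an $[R]_0$-algebra by $[R]_1$, with $k=[R]_0$ a field, and $\mathfrak m$ is its maximal homogeneous ideal. Only homogeneous ideals are considered. $M(s)$ denotes $M$ with grading $[M(s)]_j=[M]_{s+j}$. The Hilbert function of a graded module $M$ is $\mathfrak h_M(j)=\dim_k[M]_j$. A Gorenstein ideal is a perfect ideal $\mathfrak c$ such that $R/\mathfrak c$ is Gorenstein. Ideals $I,J$ are linked by a Gorenstein ideal $\mathfrak c$, written $I\sim_{\mathfrak c}J$, if $\mathfrak c\subset I\cap J$, $\mathfrak c:I=J$ and $\mathfrak c:J=I$. The canonical module $\omega_M$ of a graded module $M$ is the graded $k$-dual of $H^{\dim M}_{\mathfrak m}(M)$. Setting: $\mathfrak b\subset\mathfrak a$ are homogeneous Gorenstein ideals with $\operatorname{grade}\mathfrak b=g-1$, $\operatorname{grade}\mathfrak a=g$, and graded minimal free resolutions $$\mathbb A:\ 0\to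 A_g=R(-v)\xrightarrow{a_g}A_{g-1}\to\cdots\to A_1\xrightarrow{a_1}R\to0,$$ $$\mathbb B:\ 0\to B_{g-1}=R(-u)\xrightarrow{b_{g-1}}B_{g-2}\to\cdots\to B_1\xrightarrow{b_1}R\to0$$ of $R/\mathfrak a$ and $R/\mathfrak b$. The embedding $\mathfrak b\hookrightarrow\mathfrak a$ induces a comparison map $\alpha=(\alpha_i:B_i\to A_i)$ with $\alpha_0=\mathrm{id}$; bases are fixed and maps identified with matrices. Assume $d=u-v\ge0$. The element $y\in\mathfrak a$ is homogeneous with $\mathfrak b:y=\mathfrak b$. The embedding $(\mathfrak b,y)\hookrightarrow\mathfrak a$ induces an $R$-module homomorphism $\omega_{R/\mathfrak a}\to\omega_{R/(\mathfrak b,y)}$ that is multiplication by some homogeneous element $\omega\in R$, of degree $d+\deg y$. The element $f\in R$ is homogeneous of degree $d$ with $\mathfrak b:(\omega+fy)=\mathfrak b$. The ideal $I$ is obtained from $\mathfrak a$ by the two links $\mathfrak a\sim_{(\mathfrak b,y)}J\sim_{(\mathfrak b,\omega+fy)}I$. It is a theorem about this setting that $I$ is a Gorenstein ideal of grade $g$ and $I=\mathfrak b+(\alpha_{g-1}^*+(-1)^gfa_g^* )$, where $\alpha_{g-1}^*$, $a_g^*$ are interpreted as row vectors and the second ideal is generated by the entries of their component-wise sum. *)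

(* Defs.v *)
(* Ideals and submodules are Prop-valued sets; the classical axioms provide the
   decidability that quotients and submodules need as types.                  *)
From HB Require Import structures.
From mathcomp Require Import all_boot all_order all_algebra.
From mathcomp Require Import generic_quotient ring_quotient.
From mathcomp Require Import boolp classical_sets functions.

Set Implicit Arguments.
Unset Strict Implicit.
Unset Printing Implicit Defensive.

Import Order.TTheory GRing.Theory Num.Theory.

Local Open Scope classical_set_scope.
Local Open Scope ring_scope.

Section Submodules.
Variables (R : comNzRingType) (M : lmodType R).
Implicit Types N : set M.

Definition submodule N : Prop :=
  N 0 /\ forall (r : R) (x z : M), N x -> N z -> N (r *: x + z).

Definition span N : set M :=
  [set x | forall S : set M, submodule S -> N `<=` S -> S x].

Lemma span_submodule N : submodule (span N).
Proof.
split=> [S [] //|r x z Nx Nz S hS NS].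
by apply: hS.2; [apply: Nx|apply: Nz].
Qed.

Definition spanb N : {pred M} := fun x => `[< span N x >].

Lemma spanb_closed N : submod_closed (spanb N).
Proof.
split=> [|r x z]; first by apply/asboolP; case: (span_submodule N).
by move=> /asboolP Nx /asboolP Nz; apply/asboolP;
  apply: (span_submodule N).2.
Qed.

HB.instance Definition _ N := GRing.isSubmodClosed.Build R M (spanb N)
  (GRing.submod_closed_semi (spanb_closed N)).

(* [subm N] is the submodule generated by N and [quom N] the quotient of M by
   it; so they are N itself and M / N as soon as N is a submodule.            *)
Definition subm N : Type := {x : M | x \in spanb N}.

HB.instance Definition _ N := SubChoice.on (subm N).
HB.instance Definition _ N := [SubChoice_isSubLmodule of subm N by <:].

Definition quom N : Type := @Quotient.quot M (spanb N).

HB.instance Definition _ N := GRing.Zmodule.on (quom N).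

Definition qcls N (x : M) : quom N := (\pi_(@Quotient.quot M (spanb N)) x)%qT.

Definition qscale N (r : R) (q : quom N) : quom N :=
  qcls N (r *: (repr (q : @Quotient.quot M (spanb N)))).

Lemma qcls_eq N x z : qcls N x = qcls N z <-> span N (x - z).
Proof.
split=> [/eqP|h].
  by rewrite /qcls -Quotient.idealrBE => /asboolP.
by apply/eqP; rewrite /qcls -Quotient.idealrBE; apply/asboolP.
Qed.

Lemma qclsK N (q : quom N) :
  qcls N (repr (q : @Quotient.quot M (spanb N))) = q.
Proof. exact: reprK. Qed.

Lemma qclsD N x z : qcls N (x + z) = qcls N x + qcls N z.
Proof. by rewrite /qcls raddfD. Qed.

Lemma qscaleE N r x : qscale r (qcls N x) = qcls N (r *: x).
Proof.
apply/qcls_eq; rewrite -scalerBr.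
have /qcls_eq h := qclsK (qcls N x).
by rewrite -[_ *: _]addr0; apply: (span_submodule N).2 => //;
  apply: (span_submodule N).1.
Qed.

Lemma qscaleA N r s (q : quom N) : qscale r (qscale s q) = qscale (r * s) q.
Proof. by rewrite -[q]qclsK !qscaleE scalerA. Qed.

Lemma qscale1 N : left_id 1 (@qscale N).
Proof. by move=> q; rewrite -[q]qclsK qscaleE scale1r. Qed.

Lemma qscaleDr N : right_distributive (@qscale N) +%R.
Proof.
by move=> r p q; rewrite -[p]qclsK -[q]qclsK -qclsD !qscaleE scalerDr qclsD.
Qed.

Lemma qscaleDl N q : {morph (@qscale N)^~ q : r s / r + s}.
Proof.
by move=> r s; rewrite -[q]qclsK !qscaleE scalerDl qclsD.
Qed.

HB.instance Definition _ N := GRing.Zmodule_isLmodule.Build R (quom N)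
  (@qscaleA N) (@qscale1 N) (@qscaleDr N) (@qscaleDl N).

End Submodules.

Section Ideals.
Variable R : comNzRingType.
Implicit Types I J P : set R.

Definition ideal I : Prop := submodule (I : set R^o).

Definition ideal_gen (X : set R) : set R := span (X : set R^o).

(* the ideal (I, x) *)
Definition ideal_adj I (x : R) : set R := ideal_gen (I `|` [set x]).

Definition colon I J : set R := [set x | forall z, J z -> I (x * z)].

Definition prime_ideal P : Prop :=
  [/\ ideal P, ~ P 1 & forall x z, P (x * z) -> P x \/ P z].

Definition noetherian : Prop :=
  forall I, ideal I -> exists s : seq R, I = ideal_gen [set x | x \in s].

Definition regular_seq (s : seq R) : Prop :=
  (forall i x, (i < size s)%N ->
     ideal_gen [set z | z \in take i s] (s`_i * x) ->
     ideal_gen [set z | z \in take i s] x)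
  /\ ~ ideal_gen [set z | z \in s] 1.

Definition in_ideal I (s : seq R) : Prop := forall x, x \in s -> I x.

Definition grade I (n : nat) : Prop :=
  (exists s, [/\ regular_seq s, in_ideal I s & size s = n])
  /\ forall s, regular_seq s -> in_ideal I s -> (size s <= n)%N.

Definition annihilator (M : lmodType R) : set R :=
  [set r | forall x : M, r *: x = 0].

Definition prime_chain (M : lmodType R) (n : nat) : Prop :=
  exists P : nat -> set R,
    (forall i, (i <= n)%N -> prime_ideal (P i) /\ annihilator M `<=` P i)
    /\ forall i, (i < n)%N -> P i `<` P i.+1.

Definition krull_dim (M : lmodType R) (n : nat) : Prop :=
  prime_chain M n /\ forall m, prime_chain M m -> (m <= n)%N.

End Ideals.

Section HomologicalDimensions.
Variable R : comNzRingType.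

Definition onto (M N : Type) (h : M -> N) : Prop := forall z, exists x, h x = z.

Definition injective_module (E : lmodType R) : Prop :=
  forall (M N : lmodType R) (i : {linear M -> N}) (h : {linear M -> E}),
    injective i -> exists h' : {linear N -> E}, forall x, h' (i x) = h x.

Definition projective_module (P : lmodType R) : Prop :=
  forall (M N : lmodType R) (p : {linear M -> N}) (h : {linear P -> N}),
    onto p -> exists h' : {linear P -> M}, forall x, p (h' x) = h x.

Definition short_exact (L M N : lmodType R)
    (i : {linear L -> M}) (p : {linear M -> N}) : Prop :=
  [/\ injective i, onto p & forall x, p x = 0 <-> exists z, i z = x].

(* M has an injective resolution 0 -> M -> E^0 -> ... -> E^n -> 0 *)
Fixpoint inj_dim_le (n : nat) (M : lmodType R) : Prop :=
  if n is n'.+1 then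
    exists (E C : lmodType R) (i : {linear M -> E}) (p : {linear E -> C}),
      [/\ injective_module E, short_exact i p & inj_dim_le n' C]
  else injective_module M.

(* M has a projective resolution 0 -> P_n -> ... -> P_0 -> M -> 0 *)
Fixpoint proj_dim_le (n : nat) (M : lmodType R) : Prop :=
  if n is n'.+1 then
    exists (K P : lmodType R) (i : {linear K -> P}) (p : {linear P -> M}),
      [/\ projective_module P, short_exact i p & proj_dim_le n' K]
  else projective_module M.

Definition proj_dim (M : lmodType R) (n : nat) : Prop :=
  proj_dim_le n M /\ forall m, proj_dim_le m M -> (n <= m)%N.

Definition perfect_ideal (I : set R) : Prop :=
  exists n, grade I n /\ proj_dim (quom (I : set R^o)) n.

End HomologicalDimensions.

Definition is_localization (R S : comNzRingType) (P : set R)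
    (phi : {rmorphism R -> S}) : Prop :=
  [/\ forall x, ~ P x -> exists t, phi x * t = 1,
      forall t, exists x s, ~ P s /\ t * phi s = phi x
    & forall x, phi x = 0 -> exists s, ~ P s /\ s * x = 0].

Definition gorenstein_local (S : comNzRingType) : Prop :=
  exists n, inj_dim_le n (S^o : lmodType S).

Definition gorenstein_ring (R : comNzRingType) : Prop :=
  noetherian R /\
  forall P : set R, prime_ideal P ->
    exists (S : comNzRingType) (phi : {rmorphism R -> S}),
      is_localization P phi /\ gorenstein_local S.

(* The ring R/I is given through a surjection with kernel I. *)
Definition gorenstein_quotient (R : comNzRingType) (I : set R) : Prop :=
  exists (S : comNzRingType) (pi : {rmorphism R -> S}),
    [/\ onto pi, forall x, pi x = 0 <-> I x & gorenstein_ring S].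

(* A module with a Z-indexed family of subsets; [graded] below states that
   the family is a grading. The ring itself is graded by a family gR.         *)
Record gmod (R : comNzRingType) :=
  Gmod { gsort :> lmodType R; gdeg : int -> set gsort }.
Arguments gdeg {R} g _ _.

Section Graded.
Variables (R : comNzRingType) (gR : int -> set R).

Definition graded (M : gmod R) : Prop :=
  [/\ forall j, gdeg M j 0 /\
        forall x z, gdeg M j x -> gdeg M j z -> gdeg M j (x - z),
      forall i j (r : R) (x : M),
        gR i r -> gdeg M j x -> gdeg M (i + j) (r *: x),
      forall x : M, exists (s : seq int) (c : int -> M),
        (forall j, gdeg M j (c j)) /\ x = \sum_(j <- s) c j
    & forall (s : seq int) (c : int -> M), uniq s ->
        (forall j, gdeg M j (c j)) -> \sum_(j <- s) c j = 0 ->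
        forall j, j \in s -> c j = 0].

Definition greg : gmod R := @Gmod R R^o gR.

Definition gquo (I : set R) : gmod R :=
  @Gmod R (quom (I : set R^o))
    (fun j => [set qcls (I : set R^o) x | x in gR j]).

(* M(s) *)
Definition gshift (M : gmod R) (s : int) : gmod R :=
  @Gmod R M (fun j => gdeg M (s + j)).

Definition homogeneous (I : set R) : Prop :=
  I `<=` ideal_gen [set x | I x /\ exists j, gR j x].

Definition irr : set R := ideal_gen [set x | exists2 j, 0 < j & gR j x].

Definition gorenstein_ideal (I : set R) : Prop :=
  [/\ ideal I, homogeneous I, perfect_ideal I & gorenstein_quotient I].

(* I ~_c J *)
Definition linked (c I J : set R) : Prop :=
  [/\ gorenstein_ideal c, c `<=` I `&` J, colon c I = J & colon c J = I].

(* A complex of graded free modules F_i = (+)_p R(-fshift i p); maps act on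
   row vectors from the right.                                                *)
Record free_complex := FreeComplex {
  frank : nat -> nat;
  fshift : forall i, 'I_(frank i) -> int;
  fdiff : forall i, 'M[R]_(frank i.+1, frank i) }.

(* F is a graded minimal free resolution
   0 -> R(-s) -> F_(n-1) -> ... -> F_1 -> R -> 0 of R/I. *)
Definition min_free_resolution (I : set R) (F : free_complex)
    (n : nat) (s : int) : Prop :=
  [/\ frank F 0 = 1%N /\ (forall p : 'I_(frank F 0), fshift p = 0),
      frank F n = 1%N /\ (forall p : 'I_(frank F n), fshift p = s),
      forall i, (n < i)%N -> frank F i = 0%N,
      forall i p q, gR (fshift p - fshift q) (fdiff F i p q) /\
        irr (fdiff F i p q)
    & (forall x, I x <-> exists w : 'rV_(frank F 1), w *m fdiff F 0 = const_mx x) /\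
      forall i (w : 'rV_(frank F i.+1)),
        w *m fdiff F i = 0 <-> exists w' : 'rV_(frank F i.+2), w' *m fdiff F i.+1 = w].

Definition gmorph (M N : gmod R) (h : {linear M -> N}) : Prop :=
  forall j x, gdeg M j x -> gdeg N j (h x).

Definition giso (M N : gmod R) (h : {linear M -> N}) : Prop :=
  bijective h /\ forall j x, gdeg M j x <-> gdeg N j (h x).

(* injective object of the category of graded modules and degree 0 maps *)
Definition ginjective (E : gmod R) : Prop :=
  forall (M N : gmod R) (i : {linear M -> N}) (h : {linear M -> E}),
    graded M -> graded N -> gmorph i -> gmorph h -> injective i ->
    exists h' : {linear N -> E}, gmorph h' /\ forall x, h' (i x) = h x.

Definition ginj_resolution (M : gmod R) (E : nat -> gmod R)
    (e : {linear M -> E 0%N}) (d : forall i, {linear E i -> E i.+1}) : Prop :=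
  [/\ forall i, graded (E i) /\ ginjective (E i),
      gmorph e /\ (forall i, gmorph (d i)),
      injective e,
      forall x, d 0%N x = 0 <-> exists z, e z = x
    & forall i x, d i.+1 x = 0 <-> exists z, d i z = x].

(* Gamma_m(E) *)
Definition torsion (E : gmod R) : set E :=
  [set x | exists n, forall t : seq R, size t = n -> in_ideal irr t ->
     (\prod_(r <- t) r) *: x = 0].
Arguments torsion : clear implicits.

(* H^n_m(M) := H^n(Gamma_m(E)), for a graded injective resolution E of M *)
Section LocalCohomology.
Variables (E : nat -> gmod R) (d : forall i, {linear E i -> E i.+1}).

Definition cocycles (n : nat) : set (E n) :=
  torsion (E n) `&` [set x | d n x = 0].

Definition coboundaries (n : nat) : set (E n) :=
  match n return set (E n) with
  | 0%N => [set 0]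
  | n'.+1 => [set d n' x | x in torsion (E n')]
  end.

Definition cobound_in (n : nat) : set (subm (@cocycles n)) :=
  [set z | coboundaries (val z)].

Definition coh_class (n : nat) (z : subm (@cocycles n)) :
  quom (@cobound_in n) := qcls (@cobound_in n) z.

Definition local_cohomology (n : nat) : gmod R :=
  @Gmod R (quom (@cobound_in n))
    (fun j => [set coh_class z | z in [set z | gdeg (E n) j (val z)]]).

End LocalCohomology.

End Graded.

Section OverField.
Variables (k : fieldType) (R : comAlgType k) (gR : int -> set R).

(* R = (+)_(j >= 0) R_j, with R_0 = k, generated by R_1 as an R_0-algebra *)
Definition standard_graded : Prop :=
  [/\ graded gR (greg gR),
      forall j x, j < 0 -> gR j x -> x = 0,
      forall x, gR 0 x <-> exists a : k, x = a%:A
    & forall S : set R,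
        (forall a : k, S a%:A) ->
        (forall x z, S x -> S z -> S (x + z) /\ S (x * z)) ->
        gR 1 `<=` S -> forall x, S x].

Section KDual.
Variable M : lmodType R.

Definition kfunctional (h : M -> k) : Prop :=
  forall (a : k) (x z : M), h ((a%:A : R) *: x + z) = a * h x + h z.

Definition kfunctionalb : {pred M -> k} := fun h => `[< kfunctional h >].

Lemma kfunctional_closed : zmod_closed kfunctionalb.
Proof.
split=> [|h h' /asboolP hh /asboolP hh']; apply/asboolP => a x z.
  by rewrite /= mulr0 addr0.
rewrite /= !fctE hh hh' mulrBr opprD !addrA; congr (_ - _).
by rewrite -!addrA; congr (_ + _); rewrite addrC.
Qed.

HB.instance Definition _ := GRing.isZmodClosed.Build (M -> k) kfunctionalb
  kfunctional_closed.

(* Hom_k(M, k), with (r h)(x) = h (r x) *)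
Definition kdual : Type := {h : M -> k | h \in kfunctionalb}.

HB.instance Definition _ := SubChoice.on kdual.
HB.instance Definition _ := [SubChoice_isSubZmodule of kdual by <:].

Lemma kdual_fun (h : kdual) : kfunctional (val h).
Proof. exact/asboolP/(valP h). Qed.

Lemma kscale_subproof (r : R) (h : kdual) :
  (fun x => val h (r *: x)) \in kfunctionalb.
Proof.
have hh := kdual_fun h.
by apply/asboolP => a x z; rewrite scalerDr scalerA mulrC -scalerA hh.
Qed.

Definition kscale (r : R) (h : kdual) : kdual :=
  Sub (fun x => val h (r *: x)) (kscale_subproof r h).

Lemma kdualP (h h' : kdual) : (forall x, val h x = val h' x) -> h = h'.
Proof. by move=> e; apply/val_inj/funext. Qed.

Lemma kscaleE r h x : val (kscale r h) x = val h (r *: x).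
Proof. by rewrite SubK. Qed.

Lemma kdualD (h : kdual) x z : val h (x + z) = val h x + val h z.
Proof.
have hh := kdual_fun h.
by have := hh 1 x z; rewrite !scale1r mul1r.
Qed.

Lemma kscaleA r s h : kscale r (kscale s h) = kscale (r * s) h.
Proof. by apply: kdualP => x; rewrite !kscaleE scalerA mulrC. Qed.

Lemma kscale1 : left_id 1 kscale.
Proof. by move=> h; apply: kdualP => x; rewrite kscaleE scale1r. Qed.

Lemma kscaleDr : right_distributive kscale +%R.
Proof. by move=> r h h'; apply: kdualP => x. Qed.

Lemma kscaleDl h : {morph kscale^~ h : r s / r + s}.
Proof.
by move=> r s; apply: kdualP => x; rewrite kscaleE scalerDl kdualD.
Qed.

HB.instance Definition _ := GRing.Zmodule_isLmodule.Build R kdual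
  kscaleA kscale1 kscaleDr kscaleDl.

End KDual.

(* The functionals concentrated in degree -j span a copy of Hom_k(M_(-j), k). *)
Definition kdual_deg (M : gmod R) (j : int) : set (kdual M) :=
  [set h | forall i x, i != - j -> gdeg M i x -> val h x = 0].
Arguments kdual_deg : clear implicits.

(* the graded k-dual (+)_j Hom_k(M_(-j), k) *)
Definition gdual (M : gmod R) : gmod R :=
  @Gmod R (subm (\bigcup_j kdual_deg M j))
    (fun j => [set h | kdual_deg M j (val h)]).

(* For c included in a: the map omega_(R/a) -> omega_(R/c) induced by
   R/c ->> R/a is multiplication by w. Here phi lifts R/c ->> R/a to
   resolutions, so that H^n(phi) is the induced map in local cohomology, whose
   graded dual is the induced map of canonical modules; the latter is
   identified with R/a -> R/c, x |-> w x, through isomorphisms ta, tc of the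
   canonical modules with shifts of R/a, R/c.                                 *)
Definition canonical_map_is_mult (a c : set R) (w : R) : Prop :=
  exists (n : nat)
    (Ea Ec : nat -> gmod R)
    (ea : {linear gquo gR a -> Ea 0%N}) (ec : {linear gquo gR c -> Ec 0%N})
    (da : forall i, {linear Ea i -> Ea i.+1})
    (dc : forall i, {linear Ec i -> Ec i.+1})
    (phi : forall i, {linear Ec i -> Ea i})
    (s t : int)
    (ta : {linear gshift (gquo gR a) s -> gdual (local_cohomology gR da n)})
    (tc : {linear gshift (gquo gR c) t -> gdual (local_cohomology gR dc n)}),
    [/\ krull_dim (gquo gR a) n /\ krull_dim (gquo gR c) n,
        ginj_resolution gR ea da /\ ginj_resolution gR ec dc,
        [/\ forall i, gmorph (phi i),
            forall i x, phi i.+1 (dc i x) = da i (phi i x)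
          & forall x : R, phi 0%N (ec (qcls (c : set R^o) x)) =
              ea (qcls (a : set R^o) x)],
        giso ta /\ giso tc
      & forall (x : R) (z : subm (cocycles gR dc (n := n)))
               (z' : subm (cocycles gR da (n := n))),
          val z' = phi n (val z) ->
          val (val (tc (qcls (c : set R^o) (w * x)))) (coh_class z) =
          val (val (ta (qcls (a : set R^o) x))) (coh_class z')].

(* dim_k V for a k-subspace V of an R-module; 0 if V is infinite-dimensional,
   which does not occur for components of finitely generated graded modules.  *)
Definition is_kbasis (M : lmodType R) (V : set M) (n : nat) (e : 'I_n -> M) :
    Prop :=
  (forall i, V (e i)) /\
  forall x, V x -> exists! c : 'rV[k]_n,
    x = \sum_(i < n) ((c 0 i)%:A : R) *: e i.

Definition kdim (M : lmodType R) (V : set M) : nat :=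
  xget 0%N [set n | exists e : 'I_n -> M, is_kbasis V e].

Definition hilbert (M : gmod R) (j : int) : nat := kdim (gdeg M j).

End OverField.

(* Main.v *)
Require Import Defs.
From mathcomp Require Import all_boot all_order all_algebra.
From mathcomp Require Import boolp classical_sets functions.
From mathcomp Require Import ring zify.

Set Implicit Arguments.
Unset Strict Implicit.
Unset Printing Implicit Defensive.

Import Order.TTheory GRing.Theory Num.Theory.

Local Open Scope classical_set_scope.
Local Open Scope ring_scope.

(** Put z = omega + f * y. By the double link, y and z lie in J,
    a = (b, y) : J and I = (b, z) : J; both y and z are nonzerodivisors
    modulo b. In the total ring of fractions of S = R / b, with Q the
    fractions q such that q J is contained in S, these colon ideals are
    a / b = y Q and I / b = z Q; hence y (I / b) = z (a / b). Since
    deg z - deg y = d, the correspondence x <-> t given by y x = z t in S is an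
    isomorphism of graded S-modules between I / b and (a / b)(-d), and
    [dim [I/b]_j = dim [a/b]_(j-d)]. Subtracting this from the dimensions of
    [[R/b]_j] and [[R/b]_(j-d)] gives the formula.

    Fractions are avoided: the correspondence is the relation
    b (y * x - z * t), and [colon_adj_transfer] shows that it carries
    (b, z) : J into (b, y) : J (and back, exchanging y and z). As b is
    homogeneous, one may pass to components in the relation, which is how
    degrees are controlled ([colon_adj_graded_part]).

    The count of dimensions uses bases of one k-subspace modulo another, inside
    an arbitrary R-module: their cardinality is well defined
    ([basis_mod_uniq]), adds along chains ([basis_mod_cat]) and is preserved by
    linear correspondences ([basis_mod_rel]). The subtraction requires the
    components of R to be finite-dimensional, a consequence of noetherianity
    ([degree_spanned]). *)

(** * Bases of a k-subspace modulo another *)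

Section RelativeBases.
Variables (k : fieldType) (R : comAlgType k).

Section OneModule.
Variable M : lmodType R.
Implicit Types U V W : set M.

(** R-modules carry no k-module structure here, so k acts through [a%:A]. *)
Definition ksubspace U : Prop :=
  U 0 /\ forall (a : k) x z, U x -> U z -> U ((a%:A : R) *: x + z).

Lemma ksubspaceD U x z : ksubspace U -> U x -> U z -> U (x + z).
Proof.
by move=> [_ hU] Ux Uz; have := hU 1 x z Ux Uz; rewrite !scale1r.
Qed.

Lemma ksubspaceZ U (a : k) x : ksubspace U -> U x -> U ((a%:A : R) *: x).
Proof.
by move=> [U0 hU] Ux; have := hU a x 0 Ux U0; rewrite addr0.
Qed.

Lemma ksubspaceN U x : ksubspace U -> U x -> U (- x).
Proof.
by move=> hU /(ksubspaceZ (-1) hU); rewrite !scaleN1r.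
Qed.

Lemma ksubspaceB U x z : ksubspace U -> U x -> U z -> U (x - z).
Proof. by move=> hU Ux Uz; apply: ksubspaceD => //; apply: ksubspaceN. Qed.

Lemma ksubspace_sum U (T : finType) (F : T -> M) :
  ksubspace U -> (forall i, U (F i)) -> U (\sum_i F i).
Proof.
by move=> hU hF; elim/big_ind: _ => // [|x z]; [case: hU | apply: ksubspaceD].
Qed.

Lemma ksubspace0 : ksubspace [set 0].
Proof. by split=> // a x z -> ->; rewrite scaler0 addr0. Qed.

Lemma submodule_ksubspace U : submodule U -> ksubspace U.
Proof. by case=> U0 hU; split=> // a x z; apply: hU. Qed.

Definition lincomb n (e : 'I_n -> M) (c : 'rV[k]_n) : M :=
  \sum_i ((c 0 i)%:A : R) *: e i.

Lemma lincombP n (e : 'I_n -> M) (a : k) (c c' : 'rV[k]_n) :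
  lincomb e (a *: c + c') = (a%:A : R) *: lincomb e c + lincomb e c'.
Proof.
rewrite /lincomb scaler_sumr -big_split; apply: eq_bigr => i _ /=.
by rewrite !mxE scalerDl scalerDl scalerA mulr_algl scalerA.
Qed.

Lemma lincomb0 n (e : 'I_n -> M) : lincomb e 0 = 0.
Proof. by apply: big1 => i _; rewrite mxE !scale0r. Qed.

Lemma lincombZ n (e : 'I_n -> M) (a : k) c :
  lincomb e (a *: c) = (a%:A : R) *: lincomb e c.
Proof. by rewrite -[a *: c]addr0 lincombP lincomb0 addr0. Qed.

Lemma lincombD n (e : 'I_n -> M) c c' :
  lincomb e (c + c') = lincomb e c + lincomb e c'.
Proof. by have := lincombP e 1 c c'; rewrite !scale1r. Qed.

Lemma lincombB n (e : 'I_n -> M) c c' :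
  lincomb e (c - c') = lincomb e c - lincomb e c'.
Proof. by rewrite lincombD -(scaleN1r c') lincombZ !scaleN1r. Qed.

Lemma lincomb_delta n (e : 'I_n -> M) i : lincomb e (delta_mx 0 i) = e i.
Proof.
rewrite /lincomb (bigD1 i) //= big1 ?mxE ?eqxx ?scale1r ?addr0 //.
move=> l /negbTE li.
by rewrite mxE li andbF !scale0r.
Qed.

Lemma lincomb_mulmx m n (e : 'I_n -> M) (c : 'rV[k]_m) (C : 'M[k]_(m, n)) :
  lincomb e (c *m C) = lincomb (fun i => lincomb e (row i C)) c.
Proof.
rewrite mulmx_sum_row; symmetry; rewrite [LHS]/lincomb.
apply: (big_ind2 (fun x c => x = lincomb e c)) => [|x c1 z c2 -> ->|i _].
- by rewrite lincomb0.
- by rewrite lincombD.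
- by rewrite lincombZ.
Qed.

Lemma ksubspace_lincomb U n (e : 'I_n -> M) c :
  ksubspace U -> (forall i, U (e i)) -> U (lincomb e c).
Proof. by move=> hU Ue; apply: ksubspace_sum => // i; apply: ksubspaceZ. Qed.

Definition free_mod U n (e : 'I_n -> M) : Prop :=
  forall c, U (lincomb e c) -> c = 0.

Definition spans_mod V U n (e : 'I_n -> M) : Prop :=
  forall x, V x -> exists c, U (x - lincomb e c).

(** Bases of (V + U) / U, without forming the quotient. As U may be larger than
    V, the degree j part of R / I is described by V = R_j and U = I. *)
Definition basis_mod V U n (e : 'I_n -> M) : Prop :=
  [/\ forall i, V (e i), free_mod U e & spans_mod V U e].

(** Expressing e in terms of s modulo U gives an m x n matrix, and a nonzero row
    vector killed by it would be a relation between the e i modulo U. *)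
Lemma free_mod_leq_spans V U m n (e : 'I_m -> M) (s : 'I_n -> M) :
  ksubspace U -> (forall i, V (e i)) -> free_mod U e -> spans_mod V U s ->
  (m <= n)%N.
Proof.
move=> hU Ve fe ss; have /choice [C hC] i := ss _ (Ve i).
pose A : 'M_(m, n) := \matrix_(i, l) C i 0 l.
rewrite leqNgt; apply/negP => lt_nm.
have : kermx A != 0.
  rewrite kermx_eq0; apply/negP => /eqP rA.
  by have := rank_leq_col A; rewrite rA leqNgt lt_nm.
case/rowV0Pn=> w /sub_kermxP wA /negP; apply; apply/eqP/fe.
have rowA i : row i A = C i by apply/rowP=> l; rewrite !mxE.
have <- : lincomb (fun i => e i - lincomb s (C i)) w = lincomb e w.
  rewrite -[RHS]subr0 -(lincomb0 s) -wA lincomb_mulmx -sumrB.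
  by apply: eq_bigr => i _; rewrite scalerBr rowA.
exact: ksubspace_lincomb.
Qed.

Lemma basis_mod_uniq V U m n (e : 'I_m -> M) (s : 'I_n -> M) :
  ksubspace U -> basis_mod V U e -> basis_mod V U s -> m = n.
Proof.
move=> hU [Ve fe se] [Vs fs ss]; apply/eqP; rewrite eqn_leq.
by rewrite (free_mod_leq_spans hU Ve fe ss) (free_mod_leq_spans hU Vs fs se).
Qed.

(** A free family of maximal size in V: adding a vector outside its span would
    keep it free, and the size is bounded by n. *)
Lemma basis_mod_exists V W U n (s : 'I_n -> M) :
  ksubspace U -> V `<=` W -> spans_mod W U s ->
  exists m (e : 'I_m -> M), basis_mod V U e.
Proof.
move=> hU VW ss.
pose P m := `[< exists e : 'I_m -> M, (forall i, V (e i)) /\ free_mod U e >].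
have P0 : exists m, P m.
  exists 0%N; apply/asboolP; exists (fun=> 0); split=> [[]//|c _].
  by apply/rowP => -[].
have Pn m : P m -> (m <= n)%N.
  move=> /asboolP [e [Ve fe]].
  by apply: (free_mod_leq_spans hU _ fe ss) => i; apply/VW.
case: (ex_maxnP P0 Pn) => m /asboolP [e [Ve fe]] maxm.
exists m, e; split=> // x Vx; apply: contrapT => nx.
pose e' (i : 'I_m.+1) := oapp e x (unlift ord0 i).
suff /maxm : P m.+1 by rewrite ltnn.
apply/asboolP; exists e'; split=> [i|c].
  by rewrite /e'; case: unliftP => [l|] _ /=.
pose c' : 'rV[k]_m := \row_i c 0 (lift ord0 i).
have -> : lincomb e' c = ((c 0 ord0)%:A : R) *: x + lincomb e c'.
  rewrite /lincomb big_ord_recl /e' unlift_none /=; congr (_ + _).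
  by apply: eq_bigr => i _; rewrite liftK mxE.
have [c0 Uc|c0 Uc] := eqVneq (c 0 ord0) 0.
  have /fe /rowP c'0 : U (lincomb e c') by move: Uc; rewrite c0 !scale0r add0r.
  apply/rowP => i; rewrite mxE; case: (unliftP ord0 i) => [l|] -> //.
  by have := c'0 l; rewrite !mxE.
case: nx; exists (- (c 0 ord0)^-1 *: c').
have := ksubspaceZ (c 0 ord0)^-1 hU Uc.
rewrite scalerDr scalerA mulr_algl scalerA mulVf // !scale1r lincombZ.
by rewrite !scaleNr opprK.
Qed.

(** Additivity of dimension for U <= V. Only the part of V inside W counts,
    which lets V be an ideal and W a graded component of the ring. *)
Lemma basis_mod_cat U V W m n (e : 'I_m -> M) (s : 'I_n -> M) :
  ksubspace U -> ksubspace V -> ksubspace W -> U `<=` V ->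
  basis_mod (W `&` V) U e -> basis_mod W V s ->
  exists t : 'I_(m + n) -> M, basis_mod W U t.
Proof.
move=> hU hV hW UV [VWe fe se] [Ws fs ss].
have [We Ve] : (forall i, W (e i)) /\ (forall i, V (e i)).
  by split=> i; case: (VWe i).
pose t (i : 'I_(m + n)) :=
  match fintype.split i with inl l => e l | inr l => s l end.
have tE c c' : lincomb t (row_mx c c') = lincomb e c + lincomb s c'.
  rewrite [LHS]/lincomb big_split_ord; congr (_ + _); apply: eq_bigr => i _.
    by rewrite row_mxEl /t -/(unsplit (inl i)) unsplitK.
  by rewrite row_mxEr /t -/(unsplit (inr i)) unsplitK.
exists t; split=> [i|c|x Wx].
- by rewrite /t; case: fintype.split.
- rewrite -[c]hsubmxK tE => Uc.
  have r0 : rsubmx c = 0.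
    have Vl := ksubspace_lincomb (lsubmx c) hV Ve.
    apply: fs; have := ksubspaceB hV (UV _ Uc) Vl.
    by rewrite addrAC subrr add0r.
  by move: Uc; rewrite r0 lincomb0 addr0 => /fe ->; rewrite row_mx0.
- have [c' Vc'] := ss _ Wx.
  have /se [c Uc] : (W `&` V) (x - lincomb s c').
    by split=> //; apply: ksubspaceB => //; apply: ksubspace_lincomb.
  by exists (row_mx c c'); rewrite tE opprD addrA addrAC.
Qed.

(** Bases modulo 0 are the bases of the definition of dimension, and their
    cardinality determines the dimension. *)
Lemma kdim_basis V n (e : 'I_n -> M) :
  ksubspace V -> basis_mod V [set 0] e -> kdim V = n.
Proof.
move=> hV bV.
have kb m (s : 'I_m -> M) : is_kbasis V s <-> basis_mod V [set 0] s.
  split=> [[Vs us]|[Vs fs ss]]; split=> //.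
  - move=> c c0; have [c' [_ uc']] := us _ hV.1.
    have <- : c' = c by apply: uc'; rewrite -/(lincomb s c) c0.
    by apply: uc'; rewrite -/(lincomb s 0) lincomb0.
  - move=> x /us [c [xE _]]; exists c => /=.
    by apply/eqP; rewrite subr_eq0; apply/eqP.
  - move=> x /ss [c /= xE]; exists c; split=> [|c' x'E].
      by apply/eqP; rewrite -subr_eq0; apply/eqP.
    apply/esym/eqP; rewrite -subr_eq0; apply/eqP/fs => /=.
    by rewrite lincombB [lincomb s c'](esym x'E).
apply: xget_subset1; first by exists e; apply/kb.
move=> m m' [s /kb bs] [s' /kb bs'].
exact: basis_mod_uniq ksubspace0 bs bs'.
Qed.

End OneModule.

(** An isomorphism V / (U meet V) -> V' / (U' meet V') may be given by a linear
    relation: this covers both the projection to a quotient and a correspondence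
    such as y x = z t, which is not the graph of a map before reduction. *)
Lemma basis_mod_rel (M N : lmodType R) (rho : M -> N -> Prop)
    (V U : set M) (V' U' : set N) n (e : 'I_n -> M) :
  rho 0 0 ->
  (forall (a : k) x x' z z', rho x x' -> rho z z' ->
     rho ((a%:A : R) *: x + z) ((a%:A : R) *: x' + z')) ->
  (forall x, V x -> exists2 x', V' x' & rho x x') ->
  (forall x', V' x' -> exists2 x, V x & rho x x') ->
  (forall x x', rho x x' -> U x <-> U' x') ->
  basis_mod V U e -> exists e' : 'I_n -> N, basis_mod V' U' e'.
Proof.
move=> rho0 rhoP VV' V'V UU' [Ve fe se].
have /choice [e' he'] i : exists x', V' x' /\ rho (e i) x'.
  by have [x' ? ?] := VV' _ (Ve i); exists x'.
have rhoD x x' z z' : rho x x' -> rho z z' -> rho (x + z) (x' + z').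
  by move=> h h'; have := rhoP 1 _ _ _ _ h h'; rewrite !scale1r.
have rhoZ a x x' : rho x x' -> rho ((a%:A : R) *: x) ((a%:A : R) *: x').
  by move=> h; have := rhoP a _ _ _ _ h rho0; rewrite !addr0.
have rhoL c : rho (lincomb e c) (lincomb e' c).
  by apply: (big_ind2 rho) => // i _; apply/rhoZ; case: (he' i).
exists e'; split=> [i|c /(UU' _ _ (rhoL c)) /fe //|x' /V'V [x Vx xx']].
  by case: (he' i).
have [c Uc] := se _ Vx; exists c; apply: (UU' (x - lincomb e c) _ _).1 Uc.
by have := rhoD _ _ _ _ xx' (rhoZ (-1) _ _ (rhoL c)); rewrite !scaleN1r.
Qed.

Lemma hilbert_gquo_basis (gR : int -> set R) (I : set R) j n (e : 'I_n -> R^o) :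
  ideal I -> ksubspace (gR j : set R^o) ->
  basis_mod (gR j : set R^o) I e -> hilbert (gquo gR I) j = n.
Proof.
move=> hI hj bj.
have qP x : qcls (I : set R^o) x = 0 <-> I x.
  have <- : qcls (I : set R^o) 0 = 0.
    by apply: (addrI (qcls (I : set R^o) 0)); rewrite -qclsD !addr0.
  rewrite qcls_eq subr0; split=> [|Ix]; first by apply.
  by move=> S _; apply.
have qZ (r : R) x : r *: qcls (I : set R^o) x = qcls (I : set R^o) (r *: x).
  exact: qscaleE.
have [|||||e' be'] := @basis_mod_rel R^o (quom (I : set R^o))
  (fun x q => qcls (I : set R^o) x = q) (gR j) I
  [set qcls (I : set R^o) x | x in gR j] [set 0] n e _ _ _ _ _ bj.
- exact/qP/hI.1.
- by move=> a x _ z _ <- <-; rewrite qclsD qZ.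
- by move=> x jx; exists (qcls (I : set R^o) x) => //; exists x.
- by move=> _ [x jx <-]; exists x.
- by move=> x _ <-; split => /qP.
apply: kdim_basis be'; split; first by exists 0; [exact: hj.1 | exact/qP/hI.1].
move=> a _ _ [x jx <-] [z jz <-]; exists ((a%:A : R) *: (x : R^o) + z).
  exact: hj.2.
by rewrite qclsD qZ.
Qed.

End RelativeBases.

(** * Homogeneous components *)

Section HomogeneousComponents.
Variables (k : fieldType) (R : comAlgType k) (gR : int -> set R).
Hypothesis R_graded : standard_graded gR.

Lemma degree0 j : gR j 0.
Proof. by case: R_graded => -[] /(_ j) []. Qed.

Lemma degreeB j x z : gR j x -> gR j z -> gR j (x - z).
Proof. by case: R_graded => -[] /(_ j) [_ h] _ _ _ _ _ _; apply: h. Qed.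

Lemma degreeN j x : gR j x -> gR j (- x).
Proof. by move=> jx; rewrite -[- x]add0r; apply: degreeB => //; apply: degree0. Qed.

Lemma degreeD j x z : gR j x -> gR j z -> gR j (x + z).
Proof. by move=> jx jz; rewrite -[z]opprK; apply: degreeB => //; apply: degreeN. Qed.

Lemma degreeM i j x z : gR i x -> gR j z -> gR (i + j) (x * z).
Proof. by case: R_graded => -[_ h _ _] _ _ _; apply: h. Qed.

Lemma ksubspace_degree j : ksubspace (gR j : set R^o).
Proof.
split=> [|a x z jx jz]; first exact: degree0.
apply: degreeD => //; rewrite -[j]add0r; apply: degreeM => //.
by case: R_graded => _ _ /(_ a%:A) [_ h] _; apply: h; exists a.
Qed.

(** All components are recorded at once by a function with finite support, so
    that sums of decompositions are pointwise and decompositions are unique. *)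
Definition decomposes (x : R) (c : int -> R) : Prop :=
  (forall j, gR j (c j)) /\
  exists s : seq int,
    [/\ uniq s, forall j, j \notin s -> c j = 0 & x = \sum_(j <- s) c j].

Lemma sum_enlarge_support (c : int -> R) (s t : seq int) :
  uniq s -> uniq t -> {subset s <= t} -> (forall j, j \notin s -> c j = 0) ->
  \sum_(j <- s) c j = \sum_(j <- t) c j.
Proof.
move=> us ut st c0; rewrite [RHS](bigID (mem s)) /= [X in _ + X]big1 ?addr0.
  rewrite -[RHS]big_filter; apply: perm_big; apply: uniq_perm => //.
    exact: filter_uniq.
  by move=> j; rewrite mem_filter andb_idr //; apply: st.
by move=> j /c0.
Qed.

Lemma decomposesP (a : R) x c z c' :
  (forall j w, gR j w -> gR j (a * w)) ->
  decomposes x c -> decomposes z c' ->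
  decomposes (a * x + z) (fun j => a * c j + c' j).
Proof.
move=> ha [jc [s [us s0 ->]]] [jc' [s' [us' s'0 ->]]].
split=> [j|]; first by apply: degreeD; [apply: ha|].
exists (undup (s ++ s')); split=> [|j|]; first exact: undup_uniq.
  by rewrite mem_undup mem_cat negb_or => /andP [/s0 -> /s'0 ->]; rewrite mulr0 addr0.
rewrite big_split -mulr_sumr /=; congr (_ * _ + _);
  apply: sum_enlarge_support; rewrite ?undup_uniq // => j;
  by rewrite mem_undup mem_cat => ->; rewrite ?orbT.
Qed.

Lemma decomposes_zero c : decomposes 0 c -> forall j, c j = 0.
Proof.
move=> [jc [s [us s0 e]]] j.
have [js|/s0 //] := boolP (j \in s).
by case: R_graded => -[_ _ _ h] _ _ _; apply: (h s).
Qed.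

Lemma decomposes_uniq x c c' : decomposes x c -> decomposes x c' -> c = c'.
Proof.
move=> xc xc'; apply/funext => j.
have ha i w : gR i w -> gR i (-1 * w) by rewrite mulN1r; apply: degreeN.
have := decomposesP ha xc xc'; rewrite mulN1r addNr => /decomposes_zero /(_ j).
by rewrite mulN1r addrC => /eqP; rewrite subr_eq0 => /eqP.
Qed.

Lemma decomposes_homogeneous i x :
  gR i x -> decomposes x (fun j => if j == i then x else 0).
Proof.
move=> ix; split=> [j|]; first by case: eqP => [->|_] //; apply: degree0.
exists [:: i]; split=> // [j|]; first by rewrite inE => /negbTE ->.
by rewrite big_seq1 eqxx.
Qed.

Lemma decomposes_sum (s : seq int) (F : int -> R) (C : int -> int -> R) :
  (forall i, decomposes (F i) (C i)) ->
  decomposes (\sum_(i <- s) F i) (fun j => \sum_(i <- s) C i j).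
Proof.
move=> FC; elim: s => [|i s IH].
  have -> : (fun j => \sum_(i <- [::]) C i j) = (fun j => if j == 0 then 0 else 0).
    by apply/funext => j; rewrite big_nil if_same.
  by rewrite big_nil; apply/decomposes_homogeneous/degree0.
have -> : (fun j => \sum_(l <- i :: s) C l j) =
          (fun j => 1 * C i j + \sum_(l <- s) C l j).
  by apply/funext => j; rewrite big_cons mul1r.
rewrite big_cons -[F i]mul1r; apply: decomposesP => // j w.
by rewrite mul1r.
Qed.

Lemma decomposes_exists x : exists c, decomposes x c.
Proof.
case: R_graded => -[_ _ /(_ x) [s [c [jc ->]]] _] _ _ _.
exists (fun j => \sum_(i <- s) (if j == i then c i else 0)).
by apply: decomposes_sum => i; apply: decomposes_homogeneous; apply: jc.
Qed.

Definition component (j : int) (x : R) : R := xget (fun=> 0) (decomposes x) j.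

Lemma component_decomposes x : decomposes x (component^~ x).
Proof.
have [c xc] := decomposes_exists x.
by rewrite /component; case: xgetP => [c' _ //|/(_ c)].
Qed.

Lemma componentE x c : decomposes x c -> forall j, component j x = c j.
Proof.
by move=> xc j; have /(congr1 (@^~ j)) := decomposes_uniq (component_decomposes x) xc.
Qed.

Lemma component_degree j x : gR j (component j x).
Proof. by case: (component_decomposes x). Qed.

Lemma component_homogeneous i x :
  gR i x -> forall j, component j x = if j == i then x else 0.
Proof. by move=> ix; apply/componentE/decomposes_homogeneous. Qed.

Lemma componentD j x z : component j (x + z) = component j x + component j z.
Proof.
have h1 i w : gR i w -> gR i (1 * w) by rewrite mul1r.
have := decomposesP h1 (component_decomposes x) (component_decomposes z).
by rewrite mul1r => /componentE ->; rewrite mul1r.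
Qed.

Lemma component0 j : component j 0 = 0.
Proof. by rewrite (component_homogeneous (degree0 0)) if_same. Qed.

Lemma componentN j x : component j (- x) = - component j x.
Proof. by apply: (addrI (component j x)); rewrite -componentD !subrr component0. Qed.

Lemma component_sum j (s : seq int) (F : int -> R) :
  component j (\sum_(i <- s) F i) = \sum_(i <- s) component j (F i).
Proof. exact: (big_morph (component j) (componentD j) (component0 j)). Qed.

Lemma componentMl i j r x :
  gR i r -> component j (r * x) = r * component (j - i) x.
Proof.
move=> ir; have [jc [s [us s0 xE]]] := component_decomposes x.
rewrite {1}xE mulr_sumr component_sum.
transitivity (\sum_(l <- s) if l == j - i then r * component l x else 0).
  apply: eq_bigr => l _.
  rewrite (component_homogeneous (degreeM ir (jc l))) [in RHS]eq_sym subr_eq.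
  by rewrite addrC.
rewrite -big_mkcond /=.
have [js|js] := boolP (j - i \in s); last first.
  rewrite s0 // mulr0 big1_seq // => l /andP [/eqP -> ].
  by rewrite (negbTE js).
by rewrite (big_rem _ js) /= eqxx big1_seq ?addr0 // => l /andP [/eqP ->];
  rewrite mem_rem_uniqF.
Qed.

Lemma componentM j r x : exists s : seq int,
  uniq s /\ (forall i, i \notin s -> component i r = 0) /\
  component j (r * x) = \sum_(i <- s) component i r * component (j - i) x.
Proof.
have [jc [s [us s0 rE]]] := component_decomposes r.
exists s; split=> //; split=> //; rewrite {1}rE mulr_suml component_sum.
by apply: eq_bigr => i _; apply: componentMl.
Qed.

(** The elements all of whose components lie in b form an ideal, and it contains
    the homogeneous generators of b. *)
Lemma homogeneous_component (b : set R) j x :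
  ideal b -> homogeneous gR b -> b x -> b (component j x).
Proof.
move=> idb homb /homb bx; have kb := submodule_ksubspace idb.
have bS : submodule ([set x | forall j, b (component j x)] : set R^o).
  split=> [i|r w z bw bz i]; first by rewrite component0; apply: idb.1.
  rewrite componentD; have [s [_ [_ ->]]] := componentM i r w.
  apply: (ksubspaceD kb) (bz i).
  elim/big_ind: _ => [|w1 w2|l _]; first exact: idb.1.
    exact: (ksubspaceD kb).
  by rewrite -[_ * _]addr0; apply: idb.2 => //; apply: idb.1.
apply: (bx _ bS) => z [bz [i iz]] l.
by rewrite (component_homogeneous iz); case: ifP => // _; apply: idb.1.
Qed.

(** Let the ideal of elements of degree at least j be generated by s_1, .., s_n.
    In the degree j component of a combination of the s_l with coefficients r_l
    in R, only the degree 0 components of the r_l survive, since the s_l have no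
    component below j and R has none below 0. As R_0 = k, the degree j
    components of s_1, .., s_n span R_j. *)
Lemma degree_spanned j : noetherian R ->
  exists n (s : 'I_n -> R^o), spans_mod (gR j : set R^o) [set 0] s.
Proof.
move=> /(_ (ideal_gen [set x | exists2 i, j <= i & gR i x])) [].
  exact: span_submodule.
move=> s sE; exists (size s), (fun l => component j s`_l).
have low : ideal_gen [set x | exists2 i, j <= i & gR i x] `<=`
    [set x | forall i, i < j -> component i x = 0].
  move=> x; apply; last first.
    move=> z [i ji iz] l lj; rewrite (component_homogeneous iz).
    by case: eqP => // li; move: lj; rewrite li ltNge ji.
  split=> [i _|r w z hw hz i ij]; first exact: component0.
  rewrite componentD (hz i ij) addr0.
  have [t [_ [_ ->]]] := componentM i r w.
  apply: big1_seq => l _; have [l0|l0] := ltP l 0.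
    case: R_graded => _ /(_ l (component l r) l0 (component_degree l r)) -> _ _.
    by rewrite mul0r.
  by rewrite hw ?mulr0 //; lia.
have comp0 r : exists a : k, component 0 r = a%:A.
  by case: R_graded => _ _ /(_ (component 0 r)) [h _] _; apply/h/component_degree.
have high : ideal_gen [set x | x \in s] `<=`
    [set x | (forall i, i < j -> component i x = 0) /\
       exists c : 'rV[k]_(size s),
         component j x = lincomb (fun l => component j s`_l : R^o) c].
  move=> x; apply; last first.
    move=> z /= zs; have zl := zs; rewrite -index_mem in zl; split.
      by apply: low; rewrite sE => S _; apply.
    by exists (delta_mx 0 (Ordinal zl)); rewrite lincomb_delta /= nth_index.
  split=> [|r w z [w0 [c wE]] [z0 [c' zE]]].
    split=> [i _|]; first exact: component0.
    by exists 0; rewrite lincomb0 component0.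
  (* Adding 0 to the support of r makes the surviving term visible. *)
  have rw i : i <= j -> component i (r * w) = component 0 r * component i w.
    move=> ij; have [t [ut [t0 ->]]] := componentM i r w.
    have [t' [ut' t'0 tt']] : exists t' : seq int,
        [/\ uniq t', 0 \in t' & {subset t <= t'}].
      exists (undup (0 :: t)); split=> [||l lt]; first exact: undup_uniq.
        by rewrite mem_undup mem_head.
      by rewrite mem_undup inE lt orbT.
    rewrite (sum_enlarge_support ut ut' tt') => [|l /t0 ->]; last exact: mul0r.
    rewrite (big_rem 0) //= subr0 big1_seq ?addr0 // => l /=.
    rewrite mem_rem_uniq // inE => /andP [l0 _].
    have [lneg|lpos] := ltP l 0.
      case: R_graded => _ /(_ l (component l r) lneg (component_degree l r)) -> _ _.
      by rewrite mul0r.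
    by rewrite w0 ?mulr0 //; lia.
  split=> [i ij|].
    by rewrite componentD rw ?(ltW ij) // w0 // z0 // mulr0 addr0.
  have [a ra] := comp0 r; exists (a *: c + c').
  by rewrite lincombP componentD rw // ra wE zE.
move=> x jx; have [|_ [c xE]] := high x.
  by rewrite -sE => S _; apply; exists j.
by exists c; rewrite -xE (component_homogeneous jx) eqxx subrr.
Qed.

End HomogeneousComponents.

(** * Colon ideals under a double link *)

Section DoubleLink.
Variable R : comNzRingType.
Implicit Types (b J : set R) (x y z t r s : R).

Lemma idealD b x z : ideal b -> b x -> b z -> b (x + z).
Proof. by case=> _ h bx bz; have := h 1 _ _ bx bz; rewrite scale1r. Qed.

Lemma idealM b r x : ideal b -> b x -> b (r * x).
Proof. by case=> b0 h bx; have := h r _ _ bx b0; rewrite addr0. Qed.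

Lemma idealN b x : ideal b -> b x -> b (- x).
Proof. by move=> hb bx; rewrite -mulN1r; apply: idealM. Qed.

Lemma idealB b x z : ideal b -> b x -> b z -> b (x - z).
Proof. by move=> hb bx bz; apply: idealD => //; apply: idealN. Qed.

Lemma ideal_adjP b y x : ideal b ->
  ideal_adj b y x <-> exists r, b (x - r * y).
Proof.
move=> hb; split=> [|[r bx]]; last first.
  move=> S hS bS; rewrite -[x](subrK (r * y)) addrC.
  by apply: hS.2; apply: bS; [right | left].
move=> /(_ [set z | exists r, b (z - r * y)]); apply=> [|z [bz|->]].
- split=> [|r w z [r1 h1] [r2 h2]].
    by exists 0; rewrite mul0r subr0; apply: hb.1.
  exists (r * r1 + r2).
  have -> : r *: (w : R^o) + z - (r * r1 + r2) * y =
            r * (w - r1 * y) + (z - r2 * y) by rewrite /GRing.scale /=; ring.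
  by apply: idealD => //; apply: idealM.
- by exists 0; rewrite mul0r subr0.
- by exists 1; rewrite mul1r subrr; apply: hb.1.
Qed.

Lemma colon_ideal b J : ideal b -> ideal (colon b J).
Proof.
move=> hb; split=> [s _|r x z hx hz s Js]; first by rewrite mul0r; apply: hb.1.
have -> : (r *: (x : R^o) + z) * s = r * (x * s) + z * s.
  by rewrite /GRing.scale /=; ring.
by apply: idealD (hz s Js) => //; apply: idealM (hx s Js).
Qed.

Lemma colon1_cancel b z x : colon b [set z] = b -> b (z * x) -> b x.
Proof. by move=> zreg bzx; rewrite -zreg => s ->; rewrite mulrC. Qed.

(** If y x = z t modulo b and x s = r z modulo b for s in J, then
    z (t s) = y (x s) = z (r y) modulo b, and z can be cancelled. *)
Lemma colon_adj_transfer b J y z x t :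
  ideal b -> colon b [set z] = b ->
  b (y * x - z * t) ->
  colon (ideal_adj b z) J x -> colon (ideal_adj b y) J t.
Proof.
move=> hb zreg byx Jx s Js.
have /(ideal_adjP _ _ hb) [r bxs] := Jx s Js.
apply/(ideal_adjP _ _ hb); exists r; apply: (colon1_cancel zreg).
have -> : z * (t * s - r * y) = y * (x * s - r * z) - s * (y * x - z * t) by ring.
by apply: idealB => //; apply: idealM.
Qed.

(** As y lies in J, x y lies in (b, z). *)
Lemma colon_adj_exists b J y z x :
  ideal b -> J y -> colon (ideal_adj b z) J x -> exists t, b (y * x - z * t).
Proof.
move=> hb Jy Jx; have /(ideal_adjP _ _ hb) [t bxy] := Jx y Jy.
by exists t; rewrite mulrC [z * t]mulrC.
Qed.

End DoubleLink.

(** * The graded correspondence and the Hilbert functions *)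

Section HomogeneousDoubleLink.
Variables (k : fieldType) (R : comAlgType k) (gR : int -> set R).
Hypothesis R_graded : standard_graded gR.

(** Half of the correspondence in fixed degree: the relation y x = z t modulo b
    keeps holding after replacing t by the component that matches the degree of
    y x, because b is homogeneous; the transfer lemma then puts that component in
    the colon ideal. *)
Lemma colon_adj_graded_part (b J : set R) (y z : R) (dy dz i : int) x :
  ideal b -> homogeneous gR b -> J y -> gR dy y -> gR dz z ->
  colon b [set z] = b ->
  colon (ideal_adj b z) J x -> gR i x ->
  exists t, [/\ colon (ideal_adj b y) J t, gR (dy + i - dz) t &
                b (y * x - z * t)].
Proof.
move=> hb homb Jy ydeg zdeg zreg Jx ix.
have [t bt] := colon_adj_exists hb Jy Jx.
have bc : b (y * x - z * component gR (dy + i - dz) t).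
  have := homogeneous_component R_graded (dy + i) hb homb bt.
  rewrite (componentD R_graded) (componentN R_graded).
  rewrite (component_homogeneous R_graded (degreeM R_graded ydeg ix)) eqxx.
  by rewrite (componentMl R_graded _ _ zdeg).
exists (component gR (dy + i - dz) t); split=> //.
  exact: colon_adj_transfer hb zreg bc Jx.
exact: component_degree.
Qed.

(** dim [R/b]_j = dim [a/b]_j + dim [R/a]_j, with dim [a/b]_j represented by an
    explicit basis so that it can be transported. *)
Lemma hilbert_subideal (a b : set R) (j : int) :
  noetherian R -> ideal a -> ideal b -> b `<=` a ->
  exists n (e : 'I_n -> R^o), basis_mod (gR j `&` a : set R^o) b e /\
    hilbert (gquo gR b) j = (n + hilbert (gquo gR a) j)%N.
Proof.
move=> noeR ha hb ba.
have kj := ksubspace_degree R_graded j.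
have [ka kb] := (submodule_ksubspace ha, submodule_ksubspace hb).
have [N [s ss]] := degree_spanned R_graded j noeR.
have spans (c : set R^o) : ksubspace c -> spans_mod (gR j : set R^o) c s.
  by move=> [c0 _] x /ss [w xw]; exists w; rewrite xw.
have [n [e be]] := basis_mod_exists kb (@subIsetl _ (gR j) a) (spans b kb).
have [m [t bt]] := basis_mod_exists ka (@subset_refl _ (gR j)) (spans a ka).
have [r br] := basis_mod_cat kb ka kj ba be bt.
exists n, e; split=> //.
by rewrite (hilbert_gquo_basis hb kj br) (hilbert_gquo_basis ha kj bt).
Qed.

End HomogeneousDoubleLink.

Theorem corollary3p3
    (k : fieldType) (R : comAlgType k) (gR : int -> set R)
    (R_graded : standard_graded gR) (R_gorenstein : gorenstein_ring R)
    (g : nat) (g_gt0 : (0 < g)%N) (a b : set R)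
    (a_gor : gorenstein_ideal gR a) (b_gor : gorenstein_ideal gR b)
    (b_sub_a : b `<=` a) (grade_b : grade b g.-1) (grade_a : grade a g)
    (A B : free_complex R) (u v : int)
    (resA : min_free_resolution gR a A g v)
    (resB : min_free_resolution gR b B g.-1 u)
    (d : int) (d_def : d = u - v) (d_ge0 : 0 <= d)
    (e : int) (y : R) (y_in_a : a y) (y_deg : gR e y)
    (y_reg : colon b [set y] = b)
    (omega : R) (omega_deg : gR (d + e) omega)
    (omega_map : canonical_map_is_mult gR a (ideal_adj b y) omega)
    (f : R) (f_deg : gR d f)
    (f_reg : colon b [set omega + f * y] = b)
    (J I : set R)
    (link_aJ : linked gR (ideal_adj b y) a J)
    (link_JI : linked gR (ideal_adj b (omega + f * y)) J I)
    (j : int) :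
  (hilbert (gquo gR I) j)%:Z =
    (hilbert (gquo gR a) (j - d))%:Z + (hilbert (gquo gR b) j)%:Z
    - (hilbert (gquo gR b) (j - d))%:Z.
Proof.
have [_ c1_sub _ aE] := link_aJ.
have [_ c2_sub IE _] := link_JI.
have [[ha _ _ _] [hb homb _ _]] := (a_gor, b_gor).
have noeR := R_gorenstein.1.
pose z := omega + f * y.
have z_deg : gR (d + e) z.
  by apply: (degreeD R_graded) => //; apply: (degreeM R_graded).
have adj_mem w : ideal_adj b w w by move=> S _; apply; right.
have [Jy Jz] : J y /\ J z.
  by split; [case: (c1_sub y (adj_mem y)) | case: (c2_sub z (adj_mem z))].
have hI : ideal I by rewrite -IE; apply/colon_ideal/span_submodule.
have bI : b `<=` I.
  by move=> x bx; have [] // := c2_sub x _ => S _; apply; left.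
have [p [E [bE ->]]] := hilbert_subideal R_graded (j - d) noeR ha hb b_sub_a.
have [q [F [bF ->]]] := hilbert_subideal R_graded j noeR hI hb bI.
suff -> : p = q by rewrite !PoszD; lia.
(* It remains to see that [a/b]_(j-d) and [I/b]_j have the same dimension. *)
have kb := submodule_ksubspace hb.
have [|a0 t x t' x' btx bt'x'|t [tj at_]|x [xj Ix]|t x btx|G bG] :=
  @basis_mod_rel k R R^o R^o (fun t x => b (y * x - z * t))
    (gR (j - d) `&` a) b (gR j `&` I) b p E _ _ _ _ _ bE.
- by rewrite !mulr0 subr0; apply: hb.1.
- have -> : y * ((a0%:A : R) *: x + x') - z * ((a0%:A : R) *: t + t') =
      (a0%:A : R) * (y * x - z * t) + (y * x' - z * t').
    by rewrite /GRing.scale /=; ring.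
  by apply: idealD => //; apply: idealM.
- rewrite -aE in at_.
  have [x [Ix xj bxt]] := colon_adj_graded_part R_graded hb homb Jz z_deg y_deg
    y_reg at_ tj.
  exists x; last by rewrite -opprB; apply: idealN.
  by split; [congr gR: xj; lia | rewrite -IE].
- rewrite -IE in Ix.
  have [t [at_ tj bxt]] := colon_adj_graded_part R_graded hb homb Jy y_deg z_deg
    f_reg Ix xj.
  by exists t => //; split; [congr gR: tj; lia | rewrite -aE].
- split=> [bt|bx]; [apply: (colon1_cancel y_reg) | apply: (colon1_cancel f_reg)].
    by rewrite -[y * x](subrK (z * t)); apply: idealD => //; apply: idealM.
  rewrite -[_ * t](subKr (y * x)).
  by apply: idealB => //; apply: idealM.
exact: basis_mod_uniq kb bG bF.
Qed.
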